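(* Let $G$ be a finite group and let $\pi_0,\ldots,\pi_{m-1}$ be a complete system of irreducible representations of $G$. Let $(\Gamma,\psi)$ be a $G$-gain graph and let $\alpha$ be a partition $\{C_0,C_1,\ldots,C_k\}$ of the vertex set $V_\Gamma$. The following are equivalent. 1. $\alpha$ is a $G$-GM partition; 2. $\alpha$ is a $\pi$-GM partition for every representation $\pi$ of $G$; 3. $\alpha$ is a $\pi_i$-GM partition for each $i=0,\ldots,m-1$; 4. $\alpha$ is a $\lambda_G$-GM partition, where $\lambda_G$ is the left regular representation of $G$.
   Context: **Representations.** Representations are homomorphisms $\pi\colon G\to GL_d(\mathbb{C})$, extended linearly to the group algebra, $\pi\colon\mathbb{C}G\to M_d(\mathbb{C})$. A complete system of irreducible representations is a list of pairwise inequivalent irreducible representations containing one representative from each equivalence class. $\lambda_G$ is the representation of degree $|G|$ given by the left multiplication action of $G$ on $\mathbb{C}G$. **Gain graphs.** $\Gamma=(V_\Gamma,E_\Gamma)$ is a finite simple graph; $u\sim v$ means $u,v$ are adjacent. A $G$-gain graph $(\Gamma,\psi)$ consists of $\Gamma$ and a map $\psi$ from ordered pairs of adjacent vertices to $G$ with $\psi(u,v)=\psi(v,u)^{-1}$. **GM partitions.** For a partition $\alpha=\{C_0,C_1,\dots,C_k\}$ of $V_\Gamma$ and $v\in V_\Gamma$, put $\Psi_i(v)=\sum_{w\in C_i,\,w\sim v}\psi(v,w)\in\mathbb{C}G$. Consider the condition ( * ) for every $v\in C_0$ and every $i\in\{1,\dots,k\}$ there exist $g_1,g_2\in G\cup\{0\}\subset\mathbb{C}G$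 such that $\Psi_i(v)=\frac{|C_i|}{2}g_1+\frac{|C_i|}{2}g_2$. - $\alpha$ is a $G$-GM partition if ( * ) holds and, for all $i,j\in\{1,\dots,k\}$ and all $v,v'\in C_i$, $\Psi_j(v)=\Psi_j(v')$. - For a representation $\pi$ of $G$, $\alpha$ is a $\pi$-GM partition if ( * ) holds and, for all $i,j\in\{1,\dots,k\}$ and all $v,v'\in C_i$, $\pi(\Psi_j(v))=\pi(\Psi_j(v'))$. *)

(* Defs.v *)
From HB Require Import structures.
From mathcomp Require Import all_boot all_order all_algebra all_fingroup.
From mathcomp Require Import mxrepresentation.
From mathcomp Require Export reals.
From mathcomp Require Export complex.

Set Implicit Arguments.
Unset Strict Implicit.
Unset Printing Implicit Defensive.

Import GroupScope GRing.Theory.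
Local Open Scope ring_scope.

Section GroupAlgebra.
Variables (F : fieldType) (gT : finGroupType).

(* F^o makes the finite functions an lmodType over F. *)
Definition group_alg := {ffun gT -> F^o}.

Definition galg_of (g : gT) : group_alg := [ffun h => (h == g)%:R].

Definition galg_mul (a b : group_alg) : group_alg :=
  \sum_(g : gT) \sum_(h : gT) (a g * b h) *: galg_of (g * h)%g.

Definition in_group0 (a : group_alg) : Prop :=
  a = 0 \/ exists g : gT, a = galg_of g.

Definition repr_galg n (rG : mx_representation F [set: gT] n)
  (a : group_alg) : 'M[F]_n := \sum_(g : gT) a g *: rG g.

Lemma galg_mulE (g h : gT) :
  galg_mul (galg_of g) (galg_of h) = galg_of (g * h)%g.
Proof.
rewrite /galg_mul (bigD1 g) //= [X in _ + X]big1 ?addr0 => [|x /negPf xg].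
  rewrite (bigD1 h) //= [X in _ + X]big1 ?addr0 => [|y /negPf yh].
    by rewrite !ffunE !eqxx mulr1 scale1r.
  by rewrite [galg_of h y]ffunE yh mulr0 scale0r.
by rewrite big1 // => y _; rewrite [galg_of g x]ffunE xg mul0r scale0r.
Qed.

(* Column j holds the coordinates, in the basis of group elements, of
   x * (enum_val j).  The library's regular_repr is built instead from right
   translation, acting on row vectors. *)
Definition left_regular_mx (x : gT) : 'M[F]_#|gT| :=
  \matrix_(i, j) galg_mul (galg_of x) (galg_of (enum_val j)) (enum_val i).

Lemma left_regular_mx_repr : mx_repr [set: gT] left_regular_mx.
Proof.
split=> [|x y _ _]; apply/matrixP => i j; rewrite !mxE galg_mulE ffunE.
  by rewrite mul1g (inj_eq enum_val_inj).
rewrite (bigD1 (enum_rank (y * enum_val j)%g)) //= big1 => [|k nk].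
  by rewrite !mxE !galg_mulE !ffunE enum_rankK eqxx mulr1 addr0 mulgA.
rewrite !mxE !galg_mulE !ffunE; case: eqP => [ek|_]; rewrite ?mulr0 //;
  case: eqP => [ek'|_]; rewrite ?mulr0 //.
all: by case/negP: nk; rewrite -?ek -?ek' enum_valK.
Qed.

Definition left_regular_repr := MxRepresentation left_regular_mx_repr.

Definition complete_irr_system (m : nat) (d : 'I_m -> nat)
    (pi : forall i : 'I_m, mx_representation F [set: gT] (d i)) : Prop :=
  [/\ forall i, mx_irreducible (pi i),
      forall i j, mx_rsim (pi i) (pi j) -> i = j
    & forall n (rho : mx_representation F [set: gT] n),
        mx_irreducible rho -> exists i, mx_rsim rho (pi i)].

End GroupAlgebra.

(* The gain of a non-adjacent pair is a junk value: it is left unconstrained and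
   is never used. *)
Record gain_graph (gT : finGroupType) (V : finType) := GainGraph {
  adj : rel V;
  gain : V -> V -> gT;
  adj_sym : symmetric adj;
  adj_irr : irreflexive adj;
  gainV : forall u v, adj u v -> gain u v = (gain v u)^-1%g
}.

Section GM.
Variables (F : fieldType) (gT : finGroupType) (V : finType).
Variables (Gamma : gain_graph gT V) (k : nat) (C : 'I_k.+1 -> {set V}).

Definition partition_family : Prop :=
  injective C /\ partition [set C i | i : 'I_k.+1] [set: V].

Definition gain_sum (i : 'I_k.+1) (v : V) : group_alg F gT :=
  \sum_(w in C i | adj Gamma w v) galg_of F (gain Gamma v w).

Definition GM_cond0 : Prop :=
  forall (v : V) (i : 'I_k.+1), v \in C ord0 -> i != ord0 ->
  exists g1 g2 : group_alg F gT, [/\ in_group0 g1, in_group0 g2 &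
    gain_sum i v = (#|C i|%:R / 2%:R) *: g1 + (#|C i|%:R / 2%:R) *: g2].

Definition G_GM_partition : Prop :=
  GM_cond0 /\
  forall i j : 'I_k.+1, i != ord0 -> j != ord0 ->
  forall v v' : V, v \in C i -> v' \in C i -> gain_sum j v = gain_sum j v'.

Definition repr_GM_partition n (rG : mx_representation F [set: gT] n) : Prop :=
  GM_cond0 /\
  forall i j : 'I_k.+1, i != ord0 -> j != ord0 ->
  forall v v' : V, v \in C i -> v' \in C i ->
  repr_galg rG (gain_sum j v) = repr_galg rG (gain_sum j v').

End GM.

(* Main.v *)
Require Import Defs.
From mathcomp Require Import all_boot all_order all_algebra all_fingroup.
From mathcomp Require Import mxrepresentation.
From mathcomp Require Import pgroup.

(** The four conditions involve the same hypothesis on [C 0] and differ only in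
    whether the equalities between the gain sums, elements of the group algebra,
    are required as such or after applying representations.  Going from the
    group algebra to all representations, and from these to the irreducible
    ones, is specialization.  The converse directions are statements of
    injectivity on the group algebra.

    The left regular representation is injective because the column of
    [repr_galg (left_regular_repr F gT) a] at the identity is the coordinate
    vector of [a] ([repr_galg_left_regular_inj]).

    A complete system of irreducible representations is jointly injective
    ([irr_system_repr_galg_inj]).  An element killed by the whole system is
    killed by every irreducible representation, since similar representations
    kill the same elements; by Maschke's theorem every representation is a sum
    of irreducible ones, so the element is killed by every representation
    ([repr_galg_semisimple_eq0]), in particular by the left regular one, and is
    therefore zero.

    Joint injectivity also shows that the system is non-empty, as the group
    algebra is not the zero ring ([irr_system_nonempty]).  This is what makes
    the hypothesis on [C 0] follow from the third condition, which asserts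
    it only through the members of the system. *)

Set Implicit Arguments.
Unset Strict Implicit.
Unset Printing Implicit Defensive.

Import GRing.Theory GroupScope.
Local Open Scope ring_scope.

Section GroupAlgebraRepresentations.
Variables (F : fieldType) (gT : finGroupType).
Implicit Types (a b : group_alg F gT).

Lemma repr_galgB n (rG : mx_representation F [set: gT] n) a b :
  repr_galg rG (a - b) = repr_galg rG a - repr_galg rG b.
Proof.
by rewrite /repr_galg -sumrB; apply: eq_bigr => g _; rewrite !ffunE scalerBl.
Qed.

(** The rectangular form covers similarities of representations as well as the
    inclusion of a submodule. *)
Lemma repr_galg_intertwine n1 n2 (rG1 : mx_representation F [set: gT] n1)
    (rG2 : mx_representation F [set: gT] n2) (B : 'M[F]_(n1, n2)) a :
  (forall g, rG1 g *m B = B *m rG2 g) ->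
  repr_galg rG1 a *m B = B *m repr_galg rG2 a.
Proof.
move=> BG; rewrite mulmx_suml mulmx_sumr; apply: eq_bigr => g _.
by rewrite -scalemxAl -scalemxAr BG.
Qed.

Lemma repr_galg_rsim_eq0 n1 n2 (rG1 : mx_representation F [set: gT] n1)
    (rG2 : mx_representation F [set: gT] n2) a :
  mx_rsim rG1 rG2 -> repr_galg rG2 a = 0 -> repr_galg rG1 a = 0.
Proof.
case=> B _ freeB BG a0; apply: (row_free_inj freeB).
rewrite mul0mx (@repr_galg_intertwine _ _ _ rG2) ?a0 ?mulmx0 // => g.
by apply: BG; rewrite inE.
Qed.

Lemma repr_galg_submod_eq0 n (rG : mx_representation F [set: gT] n)
    (U : 'M[F]_n) (Umod : mxmodule rG U) a :
  repr_galg (submod_repr Umod) a = 0 -> U *m repr_galg rG a = 0.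
Proof.
move=> a0; apply/eqP; rewrite -sub_kermx -(val_submod1 U) sub_kermx.
rewrite -(@repr_galg_intertwine _ _ (submod_repr Umod)) ?a0 ?mul0mx // => g.
by rewrite -(val_submodJ Umod) ?inE // mul1mx [RHS]val_submodE.
Qed.

(** By Maschke's theorem the space is the sum of simple submodules, each of which
    carries an irreducible representation, and a matrix whose kernel contains all
    of them is zero. *)
Lemma repr_galg_semisimple_eq0 a :
  [pchar F]^'.-group [set: gT] ->
  (forall n (rG : mx_representation F [set: gT] n),
     mx_irreducible rG -> repr_galg rG a = 0) ->
  forall n (rG : mx_representation F [set: gT] n), repr_galg rG a = 0.
Proof.
move=> charG irr0 n rG; apply/eqP.
(* Semisimplicity holds only up to double negation over a general field, which
   is harmless for a goal that is a boolean equality. *)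
apply: (mx_reducible_semisimple (mxmodule1 rG) (mx_Maschke_pchar rG charG)).
case=> I U /= simU defU _.
rewrite -[repr_galg rG a]mul1mx -sub_kermx -defU.
apply/sumsmx_subP => i _; rewrite sub_kermx; apply/eqP.
apply: (@repr_galg_submod_eq0 _ _ _ (mxsimple_module (simU i))).
exact/irr0/submod_mx_irr.
Qed.

Lemma repr_galg_left_regular_entry a h :
  repr_galg (left_regular_repr F gT) a (enum_rank h) (enum_rank 1%g) = a h.
Proof.
rewrite /repr_galg summxE (bigD1 h) //= big1 => [|g /negPf ngh].
  by rewrite !mxE galg_mulE ffunE !enum_rankK mulg1 eqxx mulr1 addr0.
by rewrite !mxE galg_mulE ffunE !enum_rankK mulg1 eq_sym ngh mulr0.
Qed.

Lemma repr_galg_left_regular_inj :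
  injective (@repr_galg F gT _ (left_regular_repr F gT)).
Proof.
move=> a b eq_ab; apply/ffunP => h.
by rewrite -!repr_galg_left_regular_entry eq_ab.
Qed.

Section CompleteSystem.
Variables (m : nat) (d : 'I_m -> nat).
Variable pi : forall i : 'I_m, mx_representation F [set: gT] (d i).
Hypothesis charG : [pchar F]^'.-group [set: gT].
Hypothesis pi_complete : complete_irr_system pi.

Lemma irr_system_repr_galg_inj a b :
  (forall i, repr_galg (pi i) a = repr_galg (pi i) b) -> a = b.
Proof.
case: pi_complete => _ _ pi_all eq_pi; apply: repr_galg_left_regular_inj.
apply/eqP; rewrite -subr_eq0 -repr_galgB; apply/eqP.
apply: repr_galg_semisimple_eq0 => // n rG /pi_all [i rG_pi].
by apply: repr_galg_rsim_eq0 rG_pi _; rewrite repr_galgB eq_pi subrr.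
Qed.

(** An empty system would identify the identity of the group algebra with 0. *)
Lemma irr_system_nonempty : exists i : 'I_m, true.
Proof.
case: (pickP 'I_m) => [i _ | no_i]; first by exists i.
have: galg_of F (1%g : gT) = 0.
  by apply: irr_system_repr_galg_inj => i; have := no_i i.
by move/ffunP/(_ 1%g)/eqP; rewrite !ffunE eqxx oner_eq0.
Qed.

End CompleteSystem.
End GroupAlgebraRepresentations.

Theorem theorem4p9 (R : realType) (gT : finGroupType)
    (m : nat) (d : 'I_m -> nat)
    (pi : forall i : 'I_m, mx_representation R[i] [set: gT] (d i))
    (pi_complete : complete_irr_system pi)
    (V : finType) (Gamma : gain_graph gT V)
    (k : nat) (C : 'I_k.+1 -> {set V}) (C_part : partition_family C) :
  [<-> G_GM_partition R[i] Gamma C;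
       forall (n : nat) (rho : mx_representation R[i] [set: gT] n),
         repr_GM_partition Gamma C rho;
       forall i : 'I_m, repr_GM_partition Gamma C (pi i);
       repr_GM_partition Gamma C (left_regular_repr R[i] gT)].
Proof.
have charG : [pchar R[i]]^'.-group [set: gT].
  by rewrite /pgroup pcharf'_nat Num.Theory.pnatr_eq0 -lt0n cardG_gt0.
have lift : (forall i, repr_GM_partition Gamma C (pi i)) ->
    G_GM_partition R[i] Gamma C.
  move=> GM_pi; split=> [|i j i0 j0 v v' vi v'i].
    by have [l _] := irr_system_nonempty charG pi_complete; case: (GM_pi l).
  apply: (irr_system_repr_galg_inj charG pi_complete) => l.
  by have [_ GMl] := GM_pi l; apply: (GMl i).
have push n (rho : mx_representation R[i] [set: gT] n) :
    G_GM_partition R[i] Gamma C -> repr_GM_partition Gamma C rho.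
  case=> GM0 GM; split=> // i j i0 j0 v v' vi v'i.
  by rewrite (GM i j i0 j0 v v').
tfae.
- by move=> GM n rho; apply: push.
- by move=> GM i; apply: GM.
- by move=> /lift; apply: push.
case=> GM0 GM; split=> // i j i0 j0 v v' vi v'i.
by apply: repr_galg_left_regular_inj; apply: (GM i).
Qed.
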